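(* Let $G$ be a graph. Then there exists a weight $\omega: E(G)\to\mathbb{Z}\setminus\{0\}$ such that the weighted adjacency matrix $A(G^{\omega})$ does not have full rank (i.e. has rank less than $|V(G)|$) if and only if $t(G)\geq 2$, where $t(G)$ is the number of $\{1,2\}$-factors of $G$.
   Context: All graphs are simple, undirected and finite. A $\{1,2\}$-factor of a graph $G$ is a spanning subgraph of $G$ that is a vertex-disjoint union of copies of $K_2$ and cycles; $t(G)$ denotes the number of $\{1,2\}$-factors of $G$. A weight of $G$ is a map $\omega: E(G)\to\mathbb{Z}\setminus\{0\}$. For $V(G)=\{v_1,\dots,v_n\}$, the weighted adjacency matrix $A(G^{\omega})=[a_{ij}]$ is the $n\times n$ matrix with $a_{ij}=\omega(v_iv_j)$ if $v_i$ and $v_j$ are adjacent and $a_{ij}=0$ otherwise.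
   Formalization: The formal theorem additionally assumes that G has at least one {1,2}-factor (t(G) ≥ 1); when t(G) = 0 every weight gives a singular matrix, so the stated equivalence fails (e.g. for the one-vertex graph). *)

(* Defs.v *)
From mathcomp Require Import all_boot all_order all_algebra.

Set Implicit Arguments.
Unset Strict Implicit.
Unset Printing Implicit Defensive.

Import GRing.Theory.

Record sgraph := SGraph {
  vertex :> finType;
  adj : rel vertex;
  adj_sym : symmetric adj;
  adj_irrefl : irreflexive adj
}.

Section Factors.
Variable G : sgraph.

(* An edge is the two-element set of its endpoints. *)
Definition edges : {set {set G}} :=
  [set [set x; y] | x in G, y in G & adj x y].

(* A subgraph without isolated vertices is represented by its edge set
   H : {set {set G}}; its vertex set is then cover H. *)

Definition is_K2 (H : {set {set G}}) : bool :=
  [exists x : G, exists y : G, (x != y) && (H == [set [set x; y]])].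

Definition cycle_edges (s : seq G) : {set {set G}} :=
  [set [set x; next s x] | x in s].

(* The bound n <= #|G| loses nothing, since s is duplicate-free. *)
Definition is_cycle (H : {set {set G}}) : bool :=
  [exists n : 'I_#|G|.+1, exists s : n.-tuple G,
     [&& 2 < n, uniq s & H == cycle_edges s]].

Definition vertex_disjoint (C : {set {set {set G}}}) : bool :=
  [forall H1 in C, forall H2 in C,
     (H1 != H2) ==> [disjoint cover H1 & cover H2]].

(* F is the edge set of a spanning subgraph of G; C is the family of the
   (edge sets of the) copies of K_2 and cycles of which it is the union. *)
Definition is_12factor (F : {set {set G}}) : bool :=
  [&& F \subset edges,
      cover F == [set: G]
    & [exists C : {set {set {set G}}},
         [&& [forall H in C, is_K2 H || is_cycle H],
             vertex_disjoint C
           & F == cover C]]].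

Definition num_12factors : nat := #|[set F | is_12factor F]|.

(* Only the values of w on edges matter: such a w is a map from the edges to
   the nonzero integers, extended arbitrarily to the other sets. *)
Definition is_weight (w : {set G} -> int) : Prop :=
  forall x, x \in edges -> w x != 0%R.

Definition weighted_adjmx (w : {set G} -> int) : 'M[int]_#|G| :=
  \matrix_(i, j) (if adj (enum_val i) (enum_val j)
                  then w [set enum_val i; enum_val j] else 0%R).

(* The rank of an integer matrix is its rank over the rationals. *)
Definition int_rank m n (A : 'M[int]_(m, n)) : nat :=
  \rank (map_mx (intr : int -> rat) A).

End Factors.

(* Main.v *)
Require Import Defs.
From mathcomp Require Import all_boot all_order all_algebra.
From mathcomp Require Import all_fingroup all_field.

(* The {1,2}-factors of G are the edge sets {{x, s x}} of the permutations s
   that move every vertex to a neighbour, and two such permutations with the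
   same edge set contribute equal terms to the Leibniz expansion of the
   determinant. If there is only one factor, the determinant is therefore a
   nonzero multiple of a single term.

   If there are two, some edge e0 lies in one and not in the other. For generic
   complex weights on the remaining edges, the determinant is a nonconstant
   polynomial in the weight of e0 with nonzero constant term, so it has a
   nonzero root. To return to the integers, rescale rows and columns by a null
   vector: the matrix then has a 0/1 null vector, i.e. the weight is a
   nowhere-zero solution of a rational linear system, and a generic rational
   solution is nowhere zero as well. *)

Set Implicit Arguments.
Unset Strict Implicit.
Unset Printing Implicit Defensive.

Import GRing.Theory Num.Theory.

(** * Edge supports of permutations *)

Section PermSupport.
Variable T : finType.
Implicit Types s t : {perm T}.

Definition perm_edges s : {set {set T}} := [set [set x; s x] | x : T].

Lemma eq_set2 (a b c d : T) :
  ([set a; b] == [set c; d]) = (a == c) && (b == d) || (a == d) && (b == c).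
Proof.
apply/eqP/idP => [/setP e|].
  have := e a; have := e b; have := e c; have := e d.
  rewrite !inE !eqxx ?orbT /= ![c == _]eq_sym ![d == _]eq_sym.
  by do 4![case: (_ == _) => //=].
by case/orP=> /andP[/eqP-> /eqP->] //; rewrite setUC.
Qed.

Lemma mem_perm_edges s x y :
  ([set x; y] \in perm_edges s) = (y == s x) || (y == (s^-1)%g x).
Proof.
apply/imsetP/idP => [[z _ /eqP]|].
  rewrite eq_set2 => /orP[/andP[/eqP-> /eqP->]|/andP[/eqP-> /eqP->]].
    by rewrite eqxx.
  by rewrite permK eqxx orbT.
case/orP=> /eqP->; first by exists x.
by exists ((s^-1)%g x) => //; rewrite permKV setUC.
Qed.

Lemma perm_edges_sub s (F : {set {set T}}) :
  (perm_edges s \subset F) = [forall x, [set x; s x] \in F].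
Proof.
apply/subsetP/forallP => [sF x|sF e /imsetP[x _ ->] //].
by apply: sF; apply: imset_f.
Qed.

(** The neighbours of [x] in the support of [s] are exactly its image and its preimage, so the
    support determines this unordered pair. *)
Lemma perm_edges_eqVinv s t x : perm_edges s = perm_edges t ->
  (s x == t x) && ((s^-1)%g x == (t^-1)%g x)
  || (s x == (t^-1)%g x) && ((s^-1)%g x == t x).
Proof.
move=> e; rewrite -eq_set2; apply/eqP/setP => y.
by rewrite !inE -!mem_perm_edges e.
Qed.

(** The exponent of [W e] in the Leibniz term of [s]: 2 if [s] swaps two distinct points forming
    [e], 1 on the rest of the support. *)
Definition edge_mult s (e : {set T}) := \sum_x ([set x; s x] == e).

(* A permutation and its inverse traverse every edge equally often, and the
   pair {s x, s^-1 x} is determined by the support. *)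
Lemma edge_mult_eq s t e :
  perm_edges s = perm_edges t -> edge_mult s e = edge_mult t e.
Proof.
move=> est.
have inv r : edge_mult r e = \sum_x ([set x; (r^-1)%g x] == e).
  rewrite /edge_mult (reindex_inj (@perm_inj _ (r^-1)%g)) /=.
  by apply: eq_bigr => x _; rewrite permKV setUC.
(* Doubled, each multiplicity becomes a sum over [x] of contributions of the image and the preimage,
   which is unchanged when the two are swapped. *)
apply: double_inj; rewrite -!addnn {2}(inv s) {2}(inv t) /edge_mult -!big_split.
apply: eq_bigr => x _ /=.
by case/orP: (perm_edges_eqVinv x est) => /andP[/eqP-> /eqP->] //; rewrite addnC.
Qed.

Lemma prod_perm_edges (R : comPzRingType) (W : {set T} -> R) s t :
  perm_edges s = perm_edges t ->
  (\prod_x W [set x; s x] = \prod_x W [set x; t x])%R.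
Proof.
move=> est.
have eqm (r : {perm T}) :
    (\prod_x W [set x; r x] = \prod_e W e ^+ edge_mult r e)%R.
  rewrite (partition_big (fun x => [set x; r x]) predT) //=.
  apply: eq_bigr => e _.
  rewrite (eq_bigr (fun=> W e)) => [|x /eqP-> //].
  by rewrite prodr_const -sum1_card big_mkcond.
by rewrite !eqm; apply: eq_bigr => e _; rewrite (edge_mult_eq e est).
Qed.

(** Each step along [s] is a step along [t] or along its inverse, hence never leaves the orbit of
    [t]. *)
Lemma porbit_sub s t x :
  perm_edges s = perm_edges t -> porbit s x \subset porbit t x.
Proof.
move=> est; apply/subsetP => y /porbitP[k ->]{y}.
elim: k => [|k IH]; first by rewrite expg0 perm1 porbit_id.
rewrite expgSr permM; move: IH; set y := (s ^+ k)%g x.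
rewrite -!eq_porbit_mem => /eqP <-.
case/orP: (perm_edges_eqVinv y est) => /andP[/eqP-> _].
  by rewrite (porbit_perm t 1).
by rewrite -!(porbitV t) (porbit_perm (t^-1)%g 1).
Qed.

(** The sign depends only on the number of points and the number of orbits. *)
Lemma odd_perm_edges s t : perm_edges s = perm_edges t -> odd_perm s = odd_perm t.
Proof.
move=> est; rewrite /odd_perm; congr (_ (+) odd #|pred_of_set _|).
apply: eq_imset => x; apply/eqP.
by rewrite eqEsubset !porbit_sub.
Qed.
End PermSupport.

(** * The Leibniz expansion grouped by support *)

Section Determinant.
Local Open Scope ring_scope.
Variable n : nat.
Implicit Types (s t : 'S_n) (E F : {set {set 'I_n}}).

Definition edge_mx (R : Type) (W : {set 'I_n} -> R) : 'M[R]_n :=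
  \matrix_(i, j) W [set i; j].

Definition supports E : {set {set {set 'I_n}}} :=
  [set perm_edges s | s : 'S_n & perm_edges s \subset E].

Lemma det_edge_mx (R : comPzRingType) (W : {set 'I_n} -> R) :
  \det (edge_mx W) = \sum_(s : 'S_n) (-1) ^+ s * \prod_i W [set i; s i].
Proof.
by apply: eq_bigr => s _; congr (_ * _); apply: eq_bigr => i _; rewrite mxE.
Qed.

Lemma sum_same_edges (R : comPzRingType) (W : {set 'I_n} -> R) s0 :
  \sum_(s : 'S_n | perm_edges s == perm_edges s0) (-1) ^+ s * \prod_i W [set i; s i]
  = ((-1) ^+ s0 * \prod_i W [set i; s0 i])
    *+ #|[pred s : 'S_n | perm_edges s == perm_edges s0]|.
Proof.
rewrite -sumr_const; apply: eq_bigr => s /eqP e.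
by rewrite (prod_perm_edges W e) (odd_perm_edges e).
Qed.

(** Equal terms cannot cancel: the sum is a positive multiple of one nonzero term, in characteristic
    0. *)
Lemma sum_same_edges_neq0 (R : numDomainType) (W : {set 'I_n} -> R) s0 :
  (forall e, e \in perm_edges s0 -> W e != 0) ->
  \sum_(s : 'S_n | perm_edges s == perm_edges s0)
     (-1) ^+ s * \prod_i W [set i; s i] != 0.
Proof.
move=> W0; rewrite sum_same_edges mulrn_eq0 negb_or -lt0n; apply/andP; split.
  by apply/card_gt0P; exists s0; rewrite inE.
rewrite mulf_neq0 ?signr_eq0 //; apply/prodf_neq0 => i _.
by apply: W0; apply: imset_f.
Qed.

Lemma prod_edges_eq0 (R : comPzRingType) (W : {set 'I_n} -> R) E s :
  (forall e, e \notin E -> W e = 0) -> ~~ (perm_edges s \subset E) ->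
  \prod_i W [set i; s i] = 0.
Proof.
move=> W0; rewrite perm_edges_sub negb_forall => /existsP[i iE].
by rewrite (bigD1 i) //= W0 // mul0r.
Qed.

Lemma det_unique_support_neq0 (R : numDomainType) (W : {set 'I_n} -> R) E :
  #|supports E| = 1%N -> (forall e, e \in E -> W e != 0) ->
  (forall e, e \notin E -> W e = 0) -> \det (edge_mx W) != 0.
Proof.
move/eqP/cards1P => [F eF] Wnz W0.
have: F \in supports E by rewrite eF set11.
case/imsetP=> s0 s0E eFs0; rewrite inE in s0E.
rewrite det_edge_mx (bigID (fun s : 'S_n => perm_edges s == perm_edges s0)) /=.
rewrite [X in _ + X]big1 ?addr0 => [|s nes].
  by apply: sum_same_edges_neq0 => e /(subsetP s0E); apply: Wnz.
rewrite (prod_edges_eq0 W0) ?mulr0 //; apply: contra nes => sE.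
have: perm_edges s \in supports E by apply/imsetP; exists s; rewrite ?inE.
by rewrite eF inE -eFs0.
Qed.

Lemma det_indicator (R : comPzRingType) F :
  \det (edge_mx (fun e => (e \in F)%:R : R))
  = \sum_(s : 'S_n | perm_edges s \subset F) (-1) ^+ s.
Proof.
rewrite det_edge_mx [RHS]big_mkcond; apply: eq_bigr => s _.
case: ifPn => [|nsF].
  rewrite perm_edges_sub => /forallP sF.
  by rewrite big1 ?mulr1 // => i _; rewrite sF.
rewrite (@prod_edges_eq0 _ (fun e => (e \in F)%:R) F) ?mulr0 // => e.
by move=> /negbTE->.
Qed.

Lemma sum_sign_same_edges_neq0 (R : numDomainType) s0 :
  \sum_(s : 'S_n | perm_edges s == perm_edges s0) (-1) ^+ s != 0 :> R.
Proof.
have := @sum_same_edges_neq0 R (fun=> 1) s0 (fun _ _ => oner_neq0 _).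
rewrite (eq_bigr (fun s : 'S_n => (-1) ^+ s)) // => s _.
by rewrite big1 ?mulr1.
Qed.

Lemma sub_supports E s :
  perm_edges s \subset E -> perm_edges s \in supports E.
Proof. by move=> sE; apply/imsetP; exists s; rewrite ?inE. Qed.

(** Take [F'] minimal among the supports: a permutation inside [F'] then has support exactly [F'],
    so all surviving signs agree. *)
Lemma det_indicator_neq0 (R : numDomainType) E F : F \in supports E ->
  exists2 F' : {set {set 'I_n}}, F' \subset F & \det (edge_mx (fun e => (e \in F')%:R : R)) != 0.
Proof.
move=> FE; have [F' /minsetP[F'E minF'] sF'] := minset_exists FE.
exists F' => //; rewrite det_indicator.
case/imsetP: (F'E) => s0; rewrite inE => s0E eF'.
rewrite (eq_bigl (fun s : 'S_n => perm_edges s == perm_edges s0)).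
  exact: sum_sign_same_edges_neq0.
move=> s; apply/idP/eqP => [sF | ->]; last by rewrite eF'.
rewrite -eF'; apply: minF' => //; apply: sub_supports.
by apply: subset_trans sF _; rewrite eF'.
Qed.

(* For F minimal among the supports through e0, the permutations inside F
   whose support contains e0 have support exactly F, hence equal signs. *)
Lemma det_indicator_drop (R : numDomainType) E F e0 :
  F \in supports E -> e0 \in F ->
  exists2 F' : {set {set 'I_n}}, F' \in supports E &
    \det (edge_mx (fun e => (e \in F')%:R : R))
    != \det (edge_mx (fun e => (e \in F' :\ e0)%:R : R)).
Proof.
move=> FE e0F.
have PF : [pred A : {set {set 'I_n}} | (A \in supports E) && (e0 \in A)] F by rewrite /= FE.
have [F' /minsetP[/= /andP[F'E e0F'] minF'] sF'] := minset_exists PF.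
exists F' => //; rewrite !det_indicator -subr_eq0.
case/imsetP: (F'E) => s0; rewrite inE => s0E eF'.
(* The permutations inside [F'] that avoid [e0] are those inside [F' :\ e0], so they cancel against
   the second determinant. *)
rewrite (bigID (fun s : 'S_n => e0 \in perm_edges s)) /=.
rewrite [X in _ + X - _](eq_bigl (fun s : 'S_n => perm_edges s \subset F' :\ e0)).
  rewrite addrK (eq_bigl (fun s : 'S_n => perm_edges s == perm_edges s0)).
    exact: sum_sign_same_edges_neq0.
  move=> s; apply/andP/eqP => [[sF es] | e]; last by rewrite e -eF'.
  rewrite -eF'; apply: minF' => //=; rewrite es andbT; apply: sub_supports.
  by apply: subset_trans sF _; rewrite eF'.
by move=> s; rewrite subsetD1.
Qed.

End Determinant.

(** * Common non-zeros of functions polynomial along lines *)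

Section Genericity.
Local Open Scope ring_scope.
Variables (K : numFieldType) (I : Type).
Implicit Types (f g : (I -> K) -> K) (v w : I -> K).

(** A substitute for multivariate polynomials. The point [u] is given by its values, which avoids
    functional extensionality. *)
Definition poly_on_lines f := forall v w, exists p : {poly K},
  forall x u, (forall i, u i = v i + x * w i) -> f u = p.[x].

Lemma poly_nonroot (p : {poly K}) : p != 0 -> exists x, p.[x] != 0.
Proof.
move=> p0; have [/hasP[x _ px]|] :=
    boolP (has (fun x => p.[x] != 0) [seq i%:R | i <- iota 0 (size p)]).
  by exists x.
rewrite -all_predC => allr.
(* The naturals below [size p] stay distinct in characteristic 0 and are too many to be all
   roots. *)
have : (size [seq (i%:R : K) | i <- iota 0 (size p)] < size p)%N.
  apply: max_poly_roots => //.
    by apply: sub_all allr => x /=; rewrite negbK.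
  by rewrite map_inj_uniq ?iota_uniq //; apply: mulrIn; rewrite oner_neq0.
by rewrite size_map size_iota ltnn.
Qed.

Lemma poly_on_linesM f g :
  poly_on_lines f -> poly_on_lines g -> poly_on_lines (fun v => f v * g v).
Proof.
move=> pf pg v w; have [p Hp] := pf v w; have [q Hq] := pg v w.
by exists (p * q) => x u e; rewrite hornerM (Hp x) // (Hq x).
Qed.

Lemma poly_on_linesB f g :
  poly_on_lines f -> poly_on_lines g -> poly_on_lines (fun v => f v - g v).
Proof.
move=> pf pg v w; have [p Hp] := pf v w; have [q Hq] := pg v w.
by exists (p - q) => x u e; rewrite hornerD hornerN (Hp x) // (Hq x).
Qed.

(** By induction on the product: on the line joining a non-zero of the partial product to a non-zero
    of the next factor, both restrict to nonzero polynomials, so some point avoids the roots of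
    both. *)
Lemma common_nonzero (J : finType) (f : J -> (I -> K) -> K) :
  (forall j, poly_on_lines (f j)) -> (forall j, exists v, f j v != 0) ->
  exists v, forall j, f j v != 0.
Proof.
move=> pf nzf.
have [_ [v]] : poly_on_lines (fun v => \prod_j f j v)
    /\ exists v, \prod_j f j v != 0.
  elim: (index_enum J) => [|j r [pr [v nzv]]].
    split; first by move=> v w; exists 1 => x u _; rewrite big_nil hornerC.
    by exists (fun=> 0); rewrite big_nil oner_neq0.
  have [w nzw] := nzf j; split.
    move=> a b; have [p Hp] := poly_on_linesM (pf j) pr a b.
    by exists p => x u e; rewrite big_cons (Hp x).
  have [p Hp] := pf j v (fun i => w i - v i).
  have [q Hq] := pr v (fun i => w i - v i).
  have p0 : p != 0.
    apply: contra nzw => /eqP p0.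
    by rewrite (Hp 1) ?p0 ?horner0 // => i; rewrite mul1r addrC subrK.
  have q0 : q != 0.
    apply: contra nzv => /eqP q0.
    by rewrite (Hq 0) ?q0 ?horner0 // => i; rewrite mul0r addr0.
  have [x] := poly_nonroot (mulf_neq0 p0 q0).
  rewrite hornerM => nz; exists (fun i => v i + x * (w i - v i)).
  by rewrite big_cons (Hp x) // (Hq x).
by move=> /prodf_neq0 nz; exists v => j; apply: nz.
Qed.

End Genericity.

(** * Singular nowhere-zero weights: closed field, rationals, integers *)

Section SingularWeight.
Local Open Scope ring_scope.
Variable n : nat.
Implicit Types (E F : {set {set 'I_n}}).

Definition restrict (R : nmodType) E (W : {set 'I_n} -> R) e :=
  if e \in E then W e else 0.

Lemma horner_det_edge_mx (R : comNzRingType) (q : {set 'I_n} -> {poly R}) x W :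
  (forall e, W e = (q e).[x]) -> \det (edge_mx W) = (\det (edge_mx q)).[x].
Proof.
move=> eW; rewrite -horner_evalE -det_map_mx; congr (\det _).
by apply/matrixP => i j; rewrite !mxE eW.
Qed.

Lemma det_restrict_poly_on_lines (K : numFieldType) E :
  poly_on_lines (fun W : {set 'I_n} -> K => \det (edge_mx (restrict E W))).
Proof.
move=> v w.
exists (\det (edge_mx (restrict E (fun e => (v e)%:P + w e *: 'X)))).
move=> x u eu; apply: horner_det_edge_mx => e; rewrite /restrict.
by case: ifP => _; rewrite ?horner0 // !hornerE eu mulrC.
Qed.

Lemma singular_closed_weight (K : numClosedFieldType) E :
  (1 < #|supports E|)%N ->
  exists W : {set 'I_n} -> K,
    (forall e, e \in E -> W e != 0) /\ \det (edge_mx (restrict E W)) = 0.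
Proof.
case/card_gt1P=> F1 [F2 [F1E F2E neF]].
wlog /subsetPn[e0 e0F1 e0F2] : F1 F2 F1E F2E neF / ~~ (F1 \subset F2).
  move=> IH; have [sF|/IH] := boolP (F1 \subset F2); last exact.
  apply: (IH F2 F1) => //; first by rewrite eq_sym.
  by apply: contra neF => sF'; rewrite eqEsubset sF.
have suppE F : F \in supports E -> F \subset E.
  by case/imsetP=> s; rewrite inE => sE ->.
(* As a polynomial in the weight of [e0], the determinant gets a nonzero constant term from [None]
   and is nonconstant by [Some None]; the other conditions keep the weights nonzero. *)
pose f (j : option (option {set 'I_n})) (W : {set 'I_n} -> K) :=
  match j with
  | None => \det (edge_mx (restrict (E :\ e0) W))
  | Some None => \det (edge_mx (restrict E W))
                 - \det (edge_mx (restrict (E :\ e0) W))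
  | Some (Some e) => W e
  end.
have [||W nzW] := @common_nonzero K _ _ f.
- case=> [[e|]|] /=; last exact: det_restrict_poly_on_lines.
    move=> v w; exists ((v e)%:P + w e *: 'X) => x u eu.
    by rewrite /f eu !hornerE mulrC.
  by apply: poly_on_linesB; apply: det_restrict_poly_on_lines.
- have restrE (A F : {set {set 'I_n}}) : F \subset A ->
      restrict A (fun e => (e \in F)%:R : K) =1 (fun e => (e \in F)%:R).
    move=> FA e; rewrite /restrict; case: ifPn => // eA.
    by rewrite (contraNF (subsetP FA e)).
  have eq_det (V V' : {set 'I_n} -> K) :
      V =1 V' -> \det (edge_mx V) = \det (edge_mx V').
    by move=> eV; congr (\det _); apply/matrixP => i j; rewrite !mxE.
  case=> [[e|]|] /=; first by exists (fun=> 1); rewrite oner_neq0.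
    have [F' F'E nz] := det_indicator_drop K F1E e0F1.
    exists (fun e => (e \in F')%:R); rewrite subr_eq0.
    rewrite (eq_det _ _ (restrE _ _ (suppE _ F'E))).
    apply: contra nz => /eqP->; apply/eqP/eq_det => e; rewrite /restrict !inE.
    have := subsetP (suppE _ F'E) e.
    by case: (e == e0) => //=; case: (e \in F') => [->|_] //; case: ifP.
  (* Since [F2] avoids [e0], a support inside it is unaffected by deleting [e0] from [E]. *)
  have [F' F'F2 nz] := det_indicator_neq0 K F2E.
  exists (fun e => (e \in F')%:R); rewrite (eq_det _ _ (restrE _ _ _)) //.
  by apply: subset_trans F'F2 _; rewrite subsetD1 e0F2 andbT suppE.
pose q e := restrict E (fun e => if e == e0 then 'X else (W e)%:P) e.
pose p := \det (edge_mx q).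
pose Wx x e := if e == e0 then x else W e.
have eqp x : \det (edge_mx (restrict E (Wx x))) = p.[x].
  apply: horner_det_edge_mx => e; rewrite /q /Wx /restrict.
  by do 2?case: ifP => _; rewrite ?hornerE.
have p0 : p.[0] = \det (edge_mx (restrict (E :\ e0) W)).
  rewrite -eqp; congr (\det _); apply/matrixP => i j; rewrite !mxE /restrict /Wx.
  by rewrite in_setD1; case: eqP => //=; case: ifP.
have p1 : p.[W e0] = \det (edge_mx (restrict E W)).
  rewrite -eqp; congr (\det _); apply/matrixP => i j; rewrite !mxE /restrict /Wx.
  by case: eqP => // ->.
(* The values of [p] at 0 and at [W e0] differ, so [p] is not constant. *)
have /closed_rootP[x /rootP px] : size p != 1%N.
  apply/negP => /size_poly1P[c _ ec].
  by have := nzW (Some None); rewrite /f -p0 -p1 ec !hornerC subrr eqxx.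
exists (Wx x); split; last by rewrite eqp.
move=> e eE; rewrite /Wx; case: (e =P e0) => [_|_]; last exact: (nzW (Some (Some e))).
(* The root is nonzero because [p] does not vanish at 0. *)
by apply: contra_eq_neq px => ->; rewrite p0; apply: (nzW None).
Qed.

(* With y a null vector of the matrix of W, the weight
   W' {i,j} = W {i,j} y_i y_j, where y_i is read as 1 when it vanishes, has the
   indicator vector of supp y as a null vector: W' is a nowhere-zero solution
   of a linear system with rational coefficients. *)
Lemma singular_rational_weight (K : numFieldType) (W : {set 'I_n} -> K) E :
  (forall i, [set i] \notin E) -> (forall e, e \in E -> W e != 0) ->
  \det (edge_mx (restrict E W)) = 0 ->
  exists V : {set 'I_n} -> rat,
    (forall e, e \in E -> V e != 0) /\ \det (edge_mx (restrict E V)) = 0.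
Proof.
move=> loopE Wnz /eqP/det0P[y ynz yM].
pose z i := if y 0 i == 0 then 1 else y 0 i.
have znz i : z i != 0 by rewrite /z; case: ifPn => // _; apply: oner_neq0.
pose N := #|{set 'I_n}|.
(* [v *m A R = 0] says that the indicator of the support of [y] is a null vector for the weight [v].
   The coefficients are 0 or 1, so the system makes sense over both [rat] and [K]. *)
pose A (R : pzSemiRingType) : 'M[R]_(N, n) := \matrix_(k, j)
  \sum_(i | y 0 i != 0) ((enum_val k \in E) && ([set i; j] == enum_val k))%:R.
have mulA (R : nzRingType) (v : 'rV[R]_N) j :
  (v *m A R) 0 j
  = \sum_(i | y 0 i != 0) restrict E (fun e => v 0 (enum_rank e)) [set i; j].
  rewrite mxE; under eq_bigr => k _ do rewrite mxE mulr_sumr.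
  rewrite exchange_big /=; apply: eq_bigr => i _.
  rewrite (bigD1 (enum_rank [set i; j])) //= enum_rankK eqxx andbT /restrict.
  rewrite big1 ?addr0 => [|k nek]; first by case: ifP; rewrite ?mulr1 ?mulr0.
  case: eqP => [ek|_]; last by rewrite andbF mulr0.
  by rewrite ek enum_valK eqxx in nek.
pose w : 'rV[K]_N := \row_k (W (enum_val k) * \prod_(i in enum_val k) z i).
have wA : w *m A K = 0.
  apply/rowP => j; rewrite mulA [RHS]mxE.
  (* Equation [j] of the system is [z j] times equation [j] of the null vector [y]. *)
  transitivity (z j * (y *m edge_mx (restrict E W)) 0 j); last first.
    by rewrite yM mxE mulr0.
  rewrite mxE mulr_sumr big_mkcond; apply: eq_bigr => i _.
  case: ifPn => [yi|]; last by rewrite negbK => /eqP->; rewrite mul0r mulr0.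
  rewrite mxE /restrict; case: ifPn => [ijE|]; last by rewrite !mulr0.
  (* Without loops the product over [[set i; j]] really has the two factors [z i] and [z j]. *)
  have ij : i != j by apply: contraTneq ijE => ->; rewrite setUid.
  rewrite mxE enum_rankK big_setU1 ?inE //= big_set1 [z i]/z (negbTE yi).
  by rewrite mulrA [RHS]mulrC [y 0 i * _]mulrC.
(* Kernels commute with field extension: [w] is a [K]-combination of rational solutions. *)
have /submxP[c ew] : (w <= map_mx ratr (kermx (A rat)))%MS.
  rewrite map_kermx; apply/sub_kermxP; rewrite -[RHS]wA; congr (_ *m _).
  apply/matrixP => k j; rewrite !mxE rmorph_sum.
  by apply: eq_bigr => i _; rewrite rmorph_nat.
(* The entry at [e] of the rational solution with coefficients [v]; the value 1 off [E] imposes no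
   condition. *)
pose f e (v : 'I_N -> rat) := if e \in E then
   \sum_k v k * kermx (A rat) k (enum_rank e) else 1.
have [||v nzv] := @common_nonzero rat _ _ f.
- move=> e a b; rewrite /f; case: (e \in E); last first.
    by exists 1 => *; rewrite hornerC.
  exists (\sum_k ((a k)%:P + b k *: 'X) * (kermx (A rat) k (enum_rank e))%:P).
  move=> x u eu; rewrite horner_sum; apply: eq_bigr => k _.
  by rewrite !hornerE eu [x * _]mulrC.
- move=> e; rewrite /f; case: (boolP (e \in E)) => eE; last first.
    by exists (fun=> 1); rewrite oner_neq0.
  have [k nzk|all0] := pickP (fun k => kermx (A rat) k (enum_rank e) != 0).
    exists (fun i => (i == k)%:R); rewrite (bigD1 k) //= eqxx mul1r big1 ?addr0 //.
    by move=> i /negbTE->; rewrite mul0r.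
  (* If all rational solutions vanished at [e], so would their combination [w]. *)
  have : w 0 (enum_rank e) != 0.
    by rewrite mxE enum_rankK mulf_neq0 ?Wnz //; apply/prodf_neq0.
  rewrite ew mxE big1 ?eqxx // => k _; rewrite mxE.
  by move/negbFE/eqP: (all0 k) => ->; rewrite rmorph0 mulr0.
pose V : 'rV[rat]_N := \row_k v k *m kermx (A rat).
exists (fun e => V 0 (enum_rank e)); split=> [e eE|].
  have := nzv e; rewrite /f eE mxE.
  by under [X in _ -> X != 0]eq_bigr => k _ do rewrite mxE.
apply/eqP/det0P; exists (\row_i (y 0 i != 0)%:R).
  apply: contra ynz => /eqP/rowP y0; apply/eqP/rowP => i.
  by move: (y0 i); rewrite !mxE; case: eqP => //= _ /eqP; rewrite oner_eq0.
apply/rowP => j; rewrite mxE [RHS]mxE.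
transitivity ((V *m A rat) 0 j); last by rewrite -mulmxA mulmx_ker mulmx0 mxE.
rewrite mulA [RHS]big_mkcond; apply: eq_bigr => i _; rewrite !mxE.
by case: (_ == _); rewrite ?mul0r ?mul1r.
Qed.

(** Multiplying by a common denominator scales the whole matrix, so it stays singular. *)
Lemma singular_integer_weight (V : {set 'I_n} -> rat) E :
  (forall e, e \in E -> V e != 0) -> \det (edge_mx (restrict E V)) = 0 ->
  exists W : {set 'I_n} -> int,
    (forall e, e \in E -> W e != 0) /\ \det (edge_mx (restrict E W)) = 0.
Proof.
move=> Vnz detV.
pose d := \prod_e denq (V e).
have dnz : d != 0 by apply/prodf_neq0 => e _; apply: denq_neq0.
pose W e := numq (V e) * \prod_(e' | e' != e) denq (V e').
have eW e : (W e)%:~R = d%:~R * V e.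
  rewrite /W /d [in RHS](bigD1 e) //= !rmorphM /= numqE.
  by rewrite [RHS]mulrC mulrA.
exists W; split=> [e eE|].
  by rewrite -(intr_eq0 rat) eW mulf_neq0 ?intr_eq0 ?Vnz.
apply/eqP; rewrite -(intr_eq0 rat) -det_map_mx.
rewrite (_ : map_mx _ _ = d%:~R *: edge_mx (restrict E V)).
  by rewrite detZ detV mulr0.
apply/matrixP => i j; rewrite !mxE /restrict.
by case: ifP => _; rewrite ?mulr0 ?rmorph0 /= ?eW.
Qed.

End SingularWeight.

(** * Factors as supports of permutations *)

Section FactorsArePermutations.
Variable G : sgraph.
Implicit Types (x y : G) (F H : {set {set G}}).

Lemma mem_edges x y : ([set x; y] \in edges G) = adj x y.
Proof.
apply/imset2P/idP => [[a b _]|xy]; last by exists x y; rewrite ?inE.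
rewrite inE => /andP[_ ab] /eqP; rewrite eq_set2.
by case/orP=> /andP[/eqP-> /eqP->] //; rewrite adj_sym.
Qed.

Lemma cover_arcs (f : G -> G) (A : {pred G}) :
  {in A, forall x, f x \in A} ->
  cover [set [set x; f x] | x in A] =i A.
Proof.
move=> fA y; rewrite cover_imset; apply/bigcupP/idP => [[x xA]|yA].
  by rewrite !inE => /orP[] /eqP-> //; apply: fA.
by exists y; rewrite ?set21.
Qed.

(** The components are the orbits of [s]: size 2 gives a copy of [K_2], larger size a cycle, and
    size 1 is excluded because [s x] is adjacent to [x]. *)
Lemma perm_edges_12factor (s : {perm G}) :
  perm_edges s \subset edges G -> is_12factor (perm_edges s).
Proof.
move=> sE.
have adjs x : adj x (s x).
  by rewrite -mem_edges (subsetP sE) //; apply: imset_f.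
have sx x : s x != x by apply: contraTneq (adjs x) => ->; rewrite adj_irrefl.
have orbs x : {in fingraph.orbit s x, forall y, s y \in fingraph.orbit s x}.
  move=> y; rewrite -!fconnect_orbit => /connect_trans; apply; exact: fconnect1.
pose comp x : {set {set G}} := [set [set y; s y] | y in fingraph.orbit s x].
have cov x : cover (comp x) =i fingraph.orbit s x by exact: cover_arcs (orbs x).
apply/and3P; split=> //.
  apply/eqP/setP => x; rewrite inE; apply/bigcupP.
  by exists [set x; s x]; rewrite ?set21 //; apply: imset_f.
apply/existsP; exists [set comp x | x : G]; apply/and3P; split.
- apply/forall_inP => H /imsetP[x _ ->{H}].
  have s_cycle := cycle_orbit (@perm_inj _ s) x.
  have s_next : {in fingraph.orbit s x, s =1 next (fingraph.orbit s x)}.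
    by move=> y yx; apply/eqP/(next_cycle s_cycle yx).
  have [o_gt2|o_lt2|o2] := ltngtP 2 (fingraph.order s x).
  + apply/orP; right; apply/existsP.
    have ltn : size (fingraph.orbit s x) < #|G|.+1.
      by rewrite ltnS size_orbit max_card.
    exists (Ordinal ltn); apply/existsP; exists (in_tuple (fingraph.orbit s x)).
    rewrite /= size_orbit o_gt2 orbit_uniq /=.
    by apply/eqP/eq_in_imset => y yx; rewrite /= -s_next.
  + have o1 : fingraph.order s x = 1.
      by apply/eqP; rewrite eqn_leq -ltnS o_lt2 fingraph.order_gt0.
    by move: s_cycle; rewrite /fingraph.orbit o1 /= (negbTE (sx x)).
  apply/orP; left; apply/existsP; exists x; apply/existsP.
  exists (s x); rewrite eq_sym sx /=.
  have orbE : fingraph.orbit s x = [:: x; s x] by rewrite /fingraph.orbit -o2.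
  have ssx : s (s x) = x by move: s_cycle; rewrite orbE /= eqxx andbT => /eqP.
  apply/eqP/setP => e; rewrite inE; apply/imsetP/eqP => [[y]|->].
    rewrite orbE !inE => /orP[] /eqP-> -> //.
    by rewrite ssx setUC.
  by exists x => //; rewrite orbE inE eqxx.
- apply/forall_inP => H1 /imsetP[x _ ->{H1}].
  apply/forall_inP => H2 /imsetP[y _ ->{H2}].
  apply/implyP; apply: contraR => /pred0Pn[z /=].
  case/andP; rewrite !cov -!fconnect_orbit => xz yz.
  have xy : fconnect s x y.
    by apply: connect_trans xz _; rewrite fconnect_sym //; apply: perm_inj.
  apply/eqP/setP => e.
  have eo : fingraph.orbit s x =i fingraph.orbit s y.
    move=> t; rewrite -!fconnect_orbit; apply: same_connect => //.
    by apply: fconnect_sym; apply: perm_inj.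
  by apply/imsetP/imsetP => -[t tx ->]; exists t; rewrite // (eo, =^~ eo).
- apply/eqP/setP => e; apply/imsetP/bigcupP => [[x _ ->]|].
    exists (comp x); first exact: imset_f.
    by apply: imset_f; rewrite -fconnect_orbit connect0.
  by case=> H /imsetP[x _ ->] /imsetP[y _ ->]; exists y.
Qed.

(** A transposition serves for [K_2] and [next] for a cycle; both fix every vertex outside the
    component. *)
Lemma component_map H : is_K2 H || is_cycle H ->
  exists2 f : {ffun G -> G}, injective f
  & (forall x, x \in cover H -> f x \in cover H)
    /\ H = [set [set x; f x] | x in cover H].
Proof.
case/orP.
  case/existsP=> x /existsP[y /andP[nexy /eqP->]].
  exists [ffun z => tperm x y z]; first by move=> a b; rewrite !ffunE => /perm_inj.
  rewrite /cover big_set1; split.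
    move=> z; rewrite ffunE !inE => /orP[] /eqP->.
      by rewrite tpermL eqxx orbT.
    by rewrite tpermR eqxx.
  by rewrite imsetU1 imset_set1 !ffunE tpermL tpermR [[set y; x]]setUC setUid.
case/existsP=> n /existsP[p /and3P[_ up /eqP->]].
exists [ffun z => next p z].
  by move=> a b; rewrite !ffunE; apply: (can_inj (prev_next up)).
have cov : cover (cycle_edges p) =i p.
  by apply: cover_arcs => x; rewrite mem_next.
split=> [x|]; first by rewrite ffunE !cov mem_next.
apply/setP => e; apply/imsetP/imsetP => -[x xp ->]; exists x;
  by rewrite ?ffunE // (cov, =^~ cov).
Qed.

(** The component maps are glued: each vertex [x] is moved by the map of its unique component
    [h x]. *)
Lemma perm_of_12factor F : is_12factor F ->
  exists s : {perm G}, perm_edges s = F.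
Proof.
case/and3P=> _ /eqP covF /existsP[C /and3P[/forall_inP compC disjC /eqP FC]].
have exH x : exists H : {set {set G}}, (H \in C) && (x \in cover H).
  have : x \in cover F by rewrite covF inE.
  case/bigcupP=> e; rewrite FC => /bigcupP[H HC eH] xe.
  by exists H; rewrite HC; apply/bigcupP; exists e.
pose h x := xchoose (exH x).
have hC x : h x \in C by case/andP: (xchooseP (exH x)).
have xh x : x \in cover (h x) by case/andP: (xchooseP (exH x)).
have h_uniq x H : H \in C -> x \in cover H -> h x = H.
  move=> HC xH; apply/eqP; apply: contraT => neH.
  have /forall_inP/(_ _ (hC x))/forall_inP/(_ _ HC) := disjC.
  by rewrite neH => /pred0P/(_ x) /=; rewrite xh xH.
pose good H (f : {ffun G -> G}) :=
  injectiveb f && ([forall x in cover H, f x \in cover H]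
    && (H == [set [set x; f x] | x in cover H])).
have exf x : exists f, good (h x) f.
  have [f injf [fH eH]] := component_map (compC _ (hC x)).
  exists f; apply/and3P; split; [exact/injectiveP| exact/forall_inP | exact/eqP].
pose f x := xchoose (exf x).
have fP x : good (h x) (f x) := xchooseP (exf x).
(* The chosen map depends only on the component, not on the vertex used to choose it. *)
have eqf x y : h x = h y -> f x = f y.
  by move=> exy; apply: eq_xchoose => g; rewrite exy.
pose sg x := f x x.
have sgh x : h (sg x) = h x.
  apply: h_uniq => //; case/and3P: (fP x) => _ /forall_inP fH _.
  exact: fH.
(* [sg] preserves components, so two vertices with the same image are moved by the same injective
   map. *)
have sg_inj : injective sg.
  move=> x y exy; have /eqf fxy : h x = h y by rewrite -sgh exy sgh.
  case/andP: (fP x) => /injectiveP injf _; apply: injf.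
  by move: exy; rewrite /sg fxy.
exists (perm sg_inj); rewrite FC; apply/setP => e; apply/imsetP/bigcupP.
  case=> x _ ->; exists (h x) => //; case/and3P: (fP x) => _ _ /eqP ->.
  by rewrite permE; apply: imset_f.
case=> H HC eH; have [x xe] : exists x, x \in e.
  have [f0 _ [_ eHf]] := component_map (compC _ HC).
  by move: eH; rewrite eHf => /imsetP[x _ ->]; exists x; rewrite set21.
have hx : h x = H by apply: h_uniq => //; apply/bigcupP; exists e.
case/and3P: (fP x) => _ _; rewrite hx => /eqP eHf.
move: eH; rewrite eHf => /imsetP[y yH ->]; exists y => //.
by rewrite permE /sg (eqf y x) // hx; apply: h_uniq.
Qed.

End FactorsArePermutations.

(** * Transport between vertices and matrix indices *)

Section IndexedGraph.
Variable G : sgraph.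

Definition vertices_of (e : {set 'I_#|G|}) : {set G} := enum_val @: e.
Definition indices_of (e : {set G}) : {set 'I_#|G|} := enum_rank @: e.

Lemma vertices_ofK : cancel vertices_of indices_of.
Proof.
by move=> e; rewrite /indices_of -imset_comp (eq_imset _ enum_valK) imset_id.
Qed.

Lemma indices_ofK : cancel indices_of vertices_of.
Proof.
by move=> e; rewrite /vertices_of -imset_comp (eq_imset _ enum_rankK) imset_id.
Qed.

Lemma vertices_of_set2 i j :
  vertices_of [set i; j] = [set enum_val i; enum_val j].
Proof. by rewrite /vertices_of imsetU1 imset_set1. Qed.

Definition index_edges : {set {set 'I_#|G|}} := vertices_of @^-1: edges G.

Lemma mem_index_edges i j :
  ([set i; j] \in index_edges) = adj (enum_val i) (enum_val j).
Proof. by rewrite inE vertices_of_set2 mem_edges. Qed.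

Lemma index_edges_loopless i : [set i] \notin index_edges.
Proof. by rewrite -[[set i]]setUid mem_index_edges adj_irrefl. Qed.

Lemma weighted_adjmxE (w : {set G} -> int) :
  weighted_adjmx w = edge_mx (restrict index_edges (w \o vertices_of)).
Proof.
apply/matrixP => i j.
by rewrite !mxE /restrict mem_index_edges /= vertices_of_set2.
Qed.

(** Conjugation by the enumeration of the vertices matches permutations of indices with permutations
    of vertices, and their supports accordingly. *)
Lemma num_12factorsE : num_12factors G = #|supports index_edges|.
Proof.
have inj : injective (fun F : {set {set 'I_#|G|}} => vertices_of @: F).
  by apply: imset_inj; apply: can_inj vertices_ofK.
rewrite -(card_imset _ inj); apply: eq_card => F; rewrite inE.
apply/idP/imsetP => [facF|[F' /imsetP[s sE ->] ->]].
  have [s es] := perm_of_12factor facF.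
  have inj_s : injective (enum_rank \o s \o @enum_val G predT).
    by apply: inj_comp (inj_comp enum_rank_inj perm_inj) enum_val_inj.
  have eF : F = [set vertices_of e | e in perm_edges (perm inj_s)].
    rewrite -es /perm_edges -imset_comp; apply/setP => e.
    apply/imsetP/imsetP => -[x _ ->].
      exists (enum_rank x) => //=.
      by rewrite vertices_of_set2 permE /= !enum_rankK.
    by exists (enum_val x) => //=; rewrite vertices_of_set2 permE /= enum_rankK.
  exists (perm_edges (perm inj_s)) => //; apply: sub_supports.
  by rewrite -sub_imset_pre -eF; case/and3P: facF.
rewrite inE in sE.
have inj_s : injective (enum_val \o s \o @enum_rank G).
  by apply: inj_comp (inj_comp enum_val_inj perm_inj) enum_rank_inj.
have -> : [set vertices_of e | e in perm_edges s] = perm_edges (perm inj_s).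
  rewrite /perm_edges -imset_comp; apply/setP => e.
  apply/imsetP/imsetP => -[x _ ->].
    exists (enum_val x) => //=.
    by rewrite vertices_of_set2 permE /= enum_valK.
  by exists (enum_rank x) => //=; rewrite vertices_of_set2 permE /= enum_rankK.
apply: perm_edges_12factor; rewrite perm_edges_sub; apply/forallP => x.
move: sE; rewrite perm_edges_sub => /forallP/(_ (enum_rank x)).
by rewrite inE vertices_of_set2 permE /= enum_rankK.
Qed.

Lemma int_rank_lt n (A : 'M[int]_n) : (int_rank A < n) = (\det A == 0)%R.
Proof.
have := row_free_unit (map_mx (intr : int -> rat) A).
rewrite unitmxE det_map_mx unitfE intr_eq0 => eA.
by rewrite ltn_neqAle rank_leq_row andbT -/(row_free _) eA negbK.
Qed.

End IndexedGraph.

(* Without a {1,2}-factor the equivalence fails: the determinant then vanishes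
   for every weight, although the number of {1,2}-factors is 0 (e.g. K_1). *)
Theorem theorem3p1 (G : sgraph) (hG : 0 < num_12factors G) :
  (exists w : {set G} -> int,
     is_weight w /\ int_rank (weighted_adjmx w) < #|G|)
  <-> 2 <= num_12factors G.
Proof.
split=> [[w [wnz]]|].
  rewrite int_rank_lt weighted_adjmxE => det0.
  rewrite ltn_neqAle hG andbT; apply: contraL det0 => /eqP t1.
  apply: (@det_unique_support_neq0 _ _ _ (index_edges G)).
  - by rewrite -num_12factorsE -t1.
  - move=> e eE; rewrite /restrict eE; apply: wnz.
    by move: eE; rewrite inE.
  - by move=> e /negbTE eE; rewrite /restrict eE.
rewrite num_12factorsE => /(singular_closed_weight algC)[W [Wnz detW]].
have [V [Vnz detV]] :=
  singular_rational_weight (@index_edges_loopless G) Wnz detW.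
have [w [wnz detw]] := singular_integer_weight Vnz detV.
exists (w \o @indices_of G); split=> [e eE|].
  by apply: wnz; rewrite inE indices_ofK.
rewrite int_rank_lt weighted_adjmxE -detw; apply/eqP; congr (\det _)%R.
by apply/matrixP => i j; rewrite !mxE /restrict /= vertices_ofK.
Qed.
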